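(* Let $X$ be a nonempty set, let $F\colon X^*\to X^*$ be an associative function, and let $m\in\mathbb{N}$. (a) $F$ is $m$-bounded if and only if $F_0,\ldots,F_{m+1}$ are $m$-bounded. (b) If $F$ is $m$-bounded, then $F$ is uniquely determined by its parts of arity at most $m+1$, i.e., if $G\colon X^*\to X^*$ is an associative $m$-bounded function such that $G_i=F_i$ for $i=0,\ldots,m+1$, then $F=G$.
   Context: $X^*=\bigcup_{n\geq 0}X^n$ is the free monoid of strings over $X$ (concatenation written as juxtaposition), and $|\mathbf{x}|$ is the length of a string. $\mathbb{N}$ is the set of nonnegative integers. $F\colon X^*\to X^*$ is associative if $F(\mathbf{x}\mathbf{y}\mathbf{z})=F(\mathbf{x}F(\mathbf{y})\mathbf{z})$ for all $\mathbf{x},\mathbf{y},\mathbf{z}\in X^*$. $F_n$ denotes the restriction of $F$ to $X^n$. A map $F\colon D\to X^*$ on a nonempty set $D$ is $m$-bounded if $|F(x)|\leq m$ for every $x\in D$. *)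

(* Defs.v *)
From mathcomp Require Import all_boot.

Set Implicit Arguments.
Unset Strict Implicit.
Unset Printing Implicit Defensive.

Section StringFunctions.

Variable X : Type.

(* The free monoid X^* is [seq X], with [++] as concatenation. *)
Definition string_associative (F : seq X -> seq X) : Prop :=
  forall x y z : seq X, F (x ++ y ++ z) = F (x ++ F y ++ z).

(* F_n, the restriction of F to X^n. *)
Definition arity_part (F : seq X -> seq X) (n : nat) (t : n.-tuple X) : seq X :=
  F t.

(* Used with D = X^* and D = X^n, which are nonempty when X is. *)
Definition bounded_by (D : Type) (m : nat) (f : D -> seq X) : Prop :=
  forall x : D, size (f x) <= m.

End StringFunctions.

Arguments arity_part {X} F n t /.

(* Main.v *)
(** Associativity gives F(sx) = F(F(s)x) for a letter x. If |F(s)| <= m, the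
    string F(s)x has length at most m+1, so both the bound and the values of F
    propagate from short strings to all strings, one letter at a time. *)

Require Import Defs.
From mathcomp Require Import all_boot.

(** Instance of associativity with empty prefix and suffix [[:: x]]. *)
Lemma string_associative_rcons (X : Type) (F : seq X -> seq X) :
  string_associative F -> forall s x, F (rcons s x) = F (rcons (F s) x).
Proof. by move=> hF s x; rewrite -!cats1; exact: (hF [::]). Qed.

Lemma bounded_by_short (X : Type) (F : seq X -> seq X) (m : nat) :
  string_associative F ->
  (forall s, size s <= m.+1 -> size (F s) <= m) -> bounded_by m F.
Proof.
move=> hF short; elim/last_ind => [|s x IHs]; first exact: short.
(* [short] is applied to [rcons (F s) x], short by induction, and not to [rcons s x]. *)
by rewrite string_associative_rcons //; apply: short; rewrite size_rcons.
Qed.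

Lemma string_associative_eq_short (X : Type) (F G : seq X -> seq X) (m : nat) :
  string_associative F -> string_associative G -> bounded_by m F ->
  (forall s, size s <= m.+1 -> F s = G s) -> F =1 G.
Proof.
move=> hF hG bF short; elim/last_ind => [|s x IHs]; first exact: short.
(* Turning [G s] into [F s] leaves [F] and [G] at one and the same string, [rcons (F s) x]. *)
rewrite string_associative_rcons // [RHS]string_associative_rcons // -IHs.
by apply: short; rewrite size_rcons ltnS; exact: bF.
Qed.

Theorem proposition2p6 (X : Type) (hX : inhabited X) (F : seq X -> seq X)
    (hF : string_associative F) (m : nat) :
  (bounded_by m F <->
     (forall i : nat, i <= m.+1 -> bounded_by m (arity_part F i))) /\
  (bounded_by m F ->
     forall G : seq X -> seq X,
       string_associative G -> bounded_by m G ->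
       (forall i : nat, i <= m.+1 ->
          arity_part G i =1 arity_part F i) ->
       F =1 G).
Proof.
split; first split=> [bF i _ t | bparts]; first exact: bF.
(* [in_tuple s] is [s] as a tuple of length [size s], which selects the arity. *)
- by apply: bounded_by_short => // s les; exact: (bparts _ les (in_tuple s)).
- move=> bF G hG _ eqGF; apply: (@string_associative_eq_short _ _ _ m) => // s les.
  by have /= -> := eqGF _ les (in_tuple s).
Qed.
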